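(* For every integer $n\ge 1$, $$d_{\lceil (n-2)/2 \rceil}^{\mathrm{-DU}}(n)= D_{\lfloor (n+2)/2 \rfloor}^{-D},$$ $$d_{\lceil (n-1)/2 \rceil}^{\mathrm{-UD}}(n)= D_{\lfloor (n+1)/2 \rfloor}^{-},$$ $$d_{\lceil n/2 \rceil}^{\mathrm{+DU}}(n)= D_{\lfloor n/2 \rfloor}^{B},$$ $$d_{\lceil (n+1)/2 \rceil}^{\mathrm{+UD}}(n)= D_{\lfloor (n-1)/2 \rfloor}^{B}.$$
   Context: A signed permutation of length $n$ is a permutation $\sigma$ of $\{-n,\ldots,-1,1,\ldots,n\}$ with $\sigma(-i)=-\sigma(i)$ for all $i\in[n]=\{1,\ldots,n\}$; write $\sigma_i=\sigma(i)$ for $i\in[n]$. The group of these is $\mathfrak{S}_n^B$. A fixed point of $\sigma$ is a positive integer $i\in[n]$ with $\sigma(i)=i$. Types of alternating signed permutations $\sigma\in\mathfrak{S}_n^B$ (the chain of alternating strict inequalities runs through $\sigma_n$): - type $\mathrm{-DU}$: $0>\sigma_1>\sigma_2<\sigma_3>\cdots$; - type $\mathrm{-UD}$: $0>\sigma_1<\sigma_2>\sigma_3<\cdots$; - type $\mathrm{+DU}$: $0<\sigma_1>\sigma_2<\sigma_3>\cdots$; - type $\mathrm{+UD}$: $0<\sigma_1<\sigma_2>\sigma_3<\cdots$. For each type $\ast\in\{\mathrm{-DU},\mathrm{-UD},\mathrm{+DU},\mathrm{+UD}\}$, $d_k^{\ast}(n)$ is the number of $\sigma\in\mathfrak{S}_n^B$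 of type $\ast$ having exactly $k$ fixed points. A derangement of type $B$ is a signed permutation with no fixed point; $\mathfrak{D}_n^B$ is the set of derangements of type $B$ in $\mathfrak{S}_n^B$. Put $D_n^B=|\mathfrak{D}_n^B|$, $D_n^{-}=|\{\sigma\in\mathfrak{D}_n^B : \sigma(1)<0\}|$, and $D_n^{-D}=|\{\sigma\in\mathfrak{D}_n^B : 0>\sigma(1)>\sigma(2)\}|$. Conventions: $D_0^B=1$ (the empty permutation), and for length $1$ the condition $\sigma(1)>\sigma(2)$ in the definition of $D_1^{-D}$ is vacuous, so $D_1^{-D}=1$. *)

(* Defs.v *)
From mathcomp Require Import all_boot all_order all_algebra all_fingroup.
Set Implicit Arguments.
Unset Strict Implicit.
Unset Printing Implicit Defensive.
Import Order.TTheory GRing.Theory Num.Theory.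
Local Open Scope ring_scope.

(* The finite set {-n,...,-1,1,...,n}: the pair (b, i) stands for the integer *)
(* i+1 if b = false and for -(i+1) if b = true.                               *)
Definition spoint (n : nat) : finType := (bool * 'I_n)%type.

Definition spoint_int (n : nat) (x : spoint n) : int :=
  if x.1 then - (x.2.+1)%:Z else (x.2.+1)%:Z.

Definition spos (n : nat) (i : 'I_n) : spoint n := (false, i).

Definition sopp (n : nat) (x : spoint n) : spoint n := (~~ x.1, x.2).

Lemma spoint_int_inj (n : nat) : injective (@spoint_int n).
Proof.
move=> [[] i] [[] j]; rewrite /spoint_int /= => H.
- by move/oppr_inj: H => [] /val_inj ->.
- by [].
- by [].
- by case: H => /val_inj ->.
Qed.

Lemma spoint_intP (n : nat) (z : int) :
  reflect (exists x : spoint n, spoint_int x = z) ((z != 0) && (`|z| <= n)%N).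
Proof.
apply: (iffP andP) => [[z0 zn]|[[[] i] <-]]; last 2 first.
- by split=> //; exact: ltn_ord.
- by split=> //; exact: ltn_ord.
case: z z0 zn => [[|m]|m] //= _ mn.
- by exists (false, Ordinal mn).
- by exists (true, Ordinal mn); rewrite /spoint_int /= NegzE.
Qed.

Lemma spoint_int_opp (n : nat) (x : spoint n) :
  spoint_int (sopp x) = - spoint_int x.
Proof. by case: x => [[] i]; rewrite /spoint_int /= ?opprK. Qed.

Definition signed_perm (n : nat) : {set {perm spoint n}} :=
  [set s : {perm spoint n} | [forall x, s (sopp x) == sopp (s x)]].

(* Positions are counted from 0: [sval_at s i] is the integer sigma_(i+1). *)
Definition sval_at (n : nat) (s : {perm spoint n}) (i : 'I_n) : int :=
  spoint_int (s (spos i)).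

Definition fixed_points (n : nat) (s : {perm spoint n}) : {set 'I_n} :=
  [set i | s (spos i) == spos i].

Definition starts_neg (n : nat) (s : {perm spoint n}) : bool :=
  [forall i : 'I_n, (i == 0%N :> nat) ==> (sval_at s i < 0)].

Definition starts_pos (n : nat) (s : {perm spoint n}) : bool :=
  [forall i : 'I_n, (i == 0%N :> nat) ==> (0 < sval_at s i)].

(* sigma_1 > sigma_2 < sigma_3 > ...; the parity of the 0-based position is   *)
(* opposite to that of the index of sigma.                                    *)
Definition altDU (n : nat) (s : {perm spoint n}) : bool :=
  [forall i : 'I_n, forall j : 'I_n, (j == i.+1 :> nat) ==>
    (if odd i then sval_at s i < sval_at s j else sval_at s i > sval_at s j)].

(* sigma_1 < sigma_2 > sigma_3 < ... *)
Definition altUD (n : nat) (s : {perm spoint n}) : bool :=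
  [forall i : 'I_n, forall j : 'I_n, (j == i.+1 :> nat) ==>
    (if odd i then sval_at s i > sval_at s j else sval_at s i < sval_at s j)].

Definition d_mDU (k n : nat) : nat :=
  #|[set s in signed_perm n |
      [&& starts_neg s, altDU s & #|fixed_points s| == k]]|.

Definition d_mUD (k n : nat) : nat :=
  #|[set s in signed_perm n |
      [&& starts_neg s, altUD s & #|fixed_points s| == k]]|.

Definition d_pDU (k n : nat) : nat :=
  #|[set s in signed_perm n |
      [&& starts_pos s, altDU s & #|fixed_points s| == k]]|.

Definition d_pUD (k n : nat) : nat :=
  #|[set s in signed_perm n |
      [&& starts_pos s, altUD s & #|fixed_points s| == k]]|.

Definition derangementsB (n : nat) : {set {perm spoint n}} :=
  [set s in signed_perm n | fixed_points s == set0].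

Definition starts_down (n : nat) (s : {perm spoint n}) : bool :=
  [forall i : 'I_n, forall j : 'I_n, (i == 0%N :> nat) && (j == 1%N :> nat) ==>
    (sval_at s i > sval_at s j)].

Definition D_B (n : nat) : nat := #|derangementsB n|.

Definition D_m (n : nat) : nat := #|[set s in derangementsB n | starts_neg s]|.

(* In length 1 there is no position 1 (0-based), so [starts_down] is vacuous. *)
Definition D_mD (n : nat) : nat :=
  #|[set s in derangementsB n | starts_neg s && starts_down s]|.

(* Main.v *)
(* Across a descent sigma_p > sigma_(p+1) at most one of p, p+1 is fixed, so   *)
(* in an alternating signed permutation with the maximal number of fixed      *)
(* points each descent pair carries exactly one fixed point, and positions    *)
(* outside the pairs are fixed unless they carry a forced negative value.     *)
(* Deleting the fixed points and relabelling leaves a derangement tau of type *)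
(* B.  Conversely tau determines sigma: the unfixed position of the i-th pair *)
(* is the left one if tau(i) > i and the right one otherwise.  The ascents    *)
(* between pairs are automatic, since sigma_p >= p at the left end of a pair  *)
(* and sigma_p <= p at its right end.                                         *)
Require Import Defs.
From mathcomp Require Import all_boot.
From mathcomp Require Import all_order all_algebra all_fingroup.
From mathcomp Require Import zify.
Import Order.TTheory GRing.Theory Num.Theory.

Set Implicit Arguments.
Unset Strict Implicit.
Unset Printing Implicit Defensive.

(** All four identities are instances of one bijection. Fix [m] disjoint slots, increasing in
    position, each a pair that must be a descent or a single position that must not be fixed, and
    ask for exactly [m] unfixed positions. Two fixed ends would form an ascent, so every slot
    contains an unfixed position, and by counting exactly one. [slot_perm_mem], [slot_perm_inj] and
    [slot_perm_onto] identify these permutations with the derangements of length [m]. Since one end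
    of each pair is fixed, the descent bounds the value at the other end ([slot_perms_bounds]); this
    gives the ascents between pairs ([slot_perms_alternate]). [card_alternating] turns the bijection
    into an equality of counts, and the four types differ only in the layout of the first
    positions. *)

Lemma spoint_int_lt n (x y : spoint n) :
  (spoint_int x < spoint_int y)%R =
  if x.1 then ~~ y.1 || (y.2 < x.2) else ~~ y.1 && (x.2 < y.2).
Proof. by case: x y => [[] i] [[] j]; rewrite /spoint_int /=; lia. Qed.

Lemma signed_permP n (s : {perm spoint n}) :
  reflect (forall x, s (sopp x) = sopp (s x)) (s \in signed_perm n).
Proof. by rewrite inE; apply: (iffP forallP) => H x; apply/eqP. Qed.

Lemma signed_perm_fixed n (s : {perm spoint n}) x :
  s \in signed_perm n -> (s x == x) = (x.2 \in fixed_points s).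
Proof.
move/signed_permP=> sS; rewrite inE; case: x => [[] i] //=.
have -> : (true, i) = sopp (spos i) by [].
rewrite sS; apply/eqP/eqP => [|-> //].
by move/(congr1 (@sopp n)); rewrite /sopp !negbK -!surjective_pairing.
Qed.

Lemma derangementsBP n (t : {perm spoint n}) :
  reflect (t \in signed_perm n /\ forall x, t x != x) (t \in derangementsB n).
Proof.
apply: (iffP setIdP) => -[tS t0]; split=> //.
  by move=> x; rewrite signed_perm_fixed // (eqP t0) inE.
by apply/eqP/setP=> i; rewrite !inE; apply/negbTE.
Qed.

(** * Inserting and deleting fixed points *)

Definition lift_point m n (e : 'I_m -> 'I_n) (x : spoint m) : spoint n :=
  (x.1, e x.2).

Lemma lift_point_inj m n (e : 'I_m -> 'I_n) :
  injective e -> injective (lift_point e).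
Proof. by move=> eI [b i] [c j] [-> /eI ->]. Qed.

Lemma lift_point_lt m n (e : 'I_m -> 'I_n) x y :
  (forall i j : 'I_m, (e i < e j) = (i < j)) ->
  (spoint_int (lift_point e x) < spoint_int (lift_point e y))%R =
  (spoint_int x < spoint_int y)%R.
Proof. by move=> eM; rewrite !spoint_int_lt /= !eM. Qed.

Definition insert_fun m n (e : 'I_m -> 'I_n) (t : spoint m -> spoint m) x :=
  if [pick y | lift_point e y == x] is Some y then lift_point e (t y) else x.

Lemma insert_fun_lift m n (e : 'I_m -> 'I_n) t y :
  injective e -> insert_fun e t (lift_point e y) = lift_point e (t y).
Proof.
move=> eI; rewrite /insert_fun; case: pickP => [z|/(_ y)]; last by rewrite eqxx.
by move/eqP/(lift_point_inj eI)=> ->.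
Qed.

Lemma insert_fun_id m n (e : 'I_m -> 'I_n) t x :
  x.2 \notin codom e -> insert_fun e t x = x.
Proof.
move=> xe; rewrite /insert_fun; case: pickP => // y /eqP xy.
by move: xe; rewrite -xy /= codom_f.
Qed.

Lemma lift_pointP m n (e : 'I_m -> 'I_n) x :
  reflect (exists y, x = lift_point e y) (x.2 \in codom e).
Proof.
apply: (iffP codomP) => [[i xi]|[y ->]]; last by exists y.2.
by exists (x.1, i); rewrite /lift_point /= -xi -surjective_pairing.
Qed.

Lemma insert_fun_inj m n (e : 'I_m -> 'I_n) t :
  injective e -> injective t -> injective (insert_fun e t).
Proof.
move=> eI tI x y.
case: (boolP (x.2 \in codom e)) => [/lift_pointP[x' ->]|xe];
  case: (boolP (y.2 \in codom e)) => [/lift_pointP[y' ->]|ye].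
- by rewrite !insert_fun_lift // => /(lift_point_inj eI)/tI ->.
- rewrite insert_fun_lift // insert_fun_id // => xy.
  by move: ye; rewrite -xy /= codom_f.
- rewrite insert_fun_lift // insert_fun_id // => xy.
  by move: xe; rewrite xy /= codom_f.
- by rewrite !insert_fun_id.
Qed.

Definition insert_perm m n (e : 'I_m -> 'I_n) (eI : injective e)
  (t : {perm spoint m}) : {perm spoint n} :=
  perm (insert_fun_inj eI (@perm_inj _ t)).

Section InsertPerm.
Context m n (e : 'I_m -> 'I_n) (eI : injective e) (t : {perm spoint m}).

Lemma insert_perm_lift y :
  insert_perm eI t (lift_point e y) = lift_point e (t y).
Proof. by rewrite permE insert_fun_lift. Qed.

Lemma insert_perm_id x : x.2 \notin codom e -> insert_perm eI t x = x.
Proof. by rewrite permE; apply: insert_fun_id. Qed.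

Lemma insert_perm_signed :
  t \in signed_perm m -> insert_perm eI t \in signed_perm n.
Proof.
move/signed_permP=> tS; apply/signed_permP=> x.
case: (boolP (x.2 \in codom e)) => [/lift_pointP[y ->]|xe].
  have -> : sopp (lift_point e y) = lift_point e (sopp y) by [].
  by rewrite !insert_perm_lift tS.
by rewrite !insert_perm_id.
Qed.

Lemma insert_perm_fixed : t \in derangementsB m ->
  forall i, (i \in fixed_points (insert_perm eI t)) = (i \notin codom e).
Proof.
case/derangementsBP=> _ t0 i.
rewrite inE; case: (boolP (i \in codom e)) => [/codomP[j ->]|ie].
  have -> : spos (e j) = lift_point e (spos j) by [].
  by rewrite insert_perm_lift (inj_eq (lift_point_inj eI)) (negbTE (t0 _)).
by rewrite insert_perm_id ?eqxx.
Qed.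

End InsertPerm.

(** Converse of insertion: [s] maps unfixed points to unfixed points, so it acts on the image of
    [e], and pulling back along [e] gives [t]. *)
Lemma restrict_perm m n (e : 'I_m -> 'I_n) (s : {perm spoint n}) :
  injective e -> s \in signed_perm n ->
  (forall i, (i \in fixed_points s) = (i \notin codom e)) ->
  exists2 t, t \in derangementsB m &
    forall y, s (lift_point e y) = lift_point e (t y).
Proof.
move=> eI sS sF; have lI := lift_point_inj eI.
have ex y : exists z, s (lift_point e y) == lift_point e z.
  have [] := lift_pointP e (s (lift_point e y)) _; last by move=> z ->; exists z.
  apply/negPn; rewrite -sF -signed_perm_fixed // (inj_eq perm_inj).
  by rewrite signed_perm_fixed // sF /= codom_f.
pose f y := xchoose (ex y).
have fE y : s (lift_point e y) = lift_point e (f y).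
  exact/eqP/(xchooseP (ex y)).
have fI : injective f.
  by move=> x y fxy; apply/lI/(@perm_inj _ s); rewrite !fE fxy.
exists (perm fI); last by move=> y; rewrite permE.
apply/derangementsBP; split.
  apply/signed_permP=> x; rewrite !permE; apply: lI.
  rewrite -fE; have -> : lift_point e (sopp x) = sopp (lift_point e x) by [].
  by rewrite (signed_permP _ sS) fE.
move=> x; rewrite permE -(inj_eq lI) -fE signed_perm_fixed //.
by rewrite sF /= codom_f.
Qed.

(** * Derangements and permutations with prescribed slots *)

(* Slot i is the pair of positions lo i < hi i, or a single one if lo i = hi i. *)
Definition slots m n (lo hi : 'I_m -> 'I_n) :=
  (forall i, lo i <= hi i) /\ (forall i j : 'I_m, i < j -> hi i < lo j).

Definition slot_choice m n (lo hi : 'I_m -> 'I_n) (b : pred 'I_m) i :=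
  if b i then lo i else hi i.

Lemma slot_choice_between m n (lo hi : 'I_m -> 'I_n) b i :
  slots lo hi -> lo i <= slot_choice lo hi b i <= hi i.
Proof. by case=> /(_ i) ? _; rewrite /slot_choice; case: (b i); lia. Qed.

Lemma slot_choice_mono m n (lo hi : 'I_m -> 'I_n) b :
  slots lo hi ->
  forall i j : 'I_m, (slot_choice lo hi b i < slot_choice lo hi b j) = (i < j).
Proof.
move=> H i j; have [_ lt] := H.
have := slot_choice_between b i H; have := slot_choice_between b j H.
case: (ltngtP i j) => [/lt|/lt|/val_inj ->]; lia.
Qed.

Lemma slot_choice_inj m n (lo hi : 'I_m -> 'I_n) b :
  slots lo hi -> injective (slot_choice lo hi b).
Proof.
move=> H i j eij; have := slot_choice_mono b H i j.
have := slot_choice_mono b H j i; rewrite eij ltnn => ji ij.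
by apply/val_inj/eqP; rewrite eqn_leq leqNgt -ji leqNgt -ij.
Qed.

Lemma slot_choice_codom m n (lo hi : 'I_m -> 'I_n) b i (p : 'I_n) :
  slots lo hi -> lo i <= p <= hi i ->
  (p \in codom (slot_choice lo hi b)) = (p == slot_choice lo hi b i).
Proof.
move=> H pi; apply/codomP/eqP => [[j pj]|->]; last by exists i.
have := slot_choice_between b j H; rewrite -pj => pj'.
rewrite pj; congr slot_choice; have [_ lt] := H.
by case: (ltngtP i j) => [/lt|/lt|/val_inj ->] //; lia.
Qed.

(** Values are compared as signed integers, so a negative value is never an excedance and goes to
    the right end of its slot. *)
Definition excedance m (t : {perm spoint m}) : pred 'I_m :=
  fun i => (spoint_int (spos i) < sval_at t i)%R.

Definition slot_perm m n (lo hi : 'I_m -> 'I_n) (H : slots lo hi)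
  (t : {perm spoint m}) : {perm spoint n} :=
  insert_perm (slot_choice_inj (b := excedance t) H) t.

Definition slot_perms m n (lo hi : 'I_m -> 'I_n) : {set {perm spoint n}} :=
  [set s in signed_perm n |
    [forall i, if lo i < hi i then (sval_at s (hi i) < sval_at s (lo i))%R
               else lo i \notin fixed_points s]
    && (#|~: fixed_points s| == m)].

Section SlotPerms.
Context m n (lo hi : 'I_m -> 'I_n) (H : slots lo hi).

Lemma slot_perm_fixed t i : t \in derangementsB m ->
  (i \in fixed_points (slot_perm H t)) =
  (i \notin codom (slot_choice lo hi (excedance t))).
Proof. by move=> tD; apply: insert_perm_fixed. Qed.

(** An excedance puts at the left end a value from a later slot, above the fixed right end.
    Otherwise the right end receives a negative value or one from an earlier slot, below the fixed
    left end. *)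
Lemma slot_perm_mem t : t \in derangementsB m -> slot_perm H t \in slot_perms lo hi.
Proof.
move=> tD; have [tS t0] := derangementsBP _ tD.
rewrite inE insert_perm_signed //=; have [le lt] := H.
have nf := slot_perm_fixed _ tD; apply/andP; split; last first.
  apply/eqP; have eI := slot_choice_inj (b := excedance t) H.
  rewrite -[RHS](card_ord m) -(card_codom eI); apply: eq_card => i.
  by rewrite inE nf negbK.
apply/forallP=> i; set e := slot_choice lo hi (excedance t).
have eE (p : 'I_n) : lo i <= p <= hi i -> (p \in codom e) = (p == e i).
  exact: slot_choice_codom.
have lohi : lo i <= lo i <= hi i by rewrite leqnn le.
have hilo : lo i <= hi i <= hi i by rewrite leqnn le.
case: ltnP => [lti|lei]; last first.
  rewrite nf negbK eE // /e /slot_choice; case: ifP => // _.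
  by rewrite -val_eqE /= eqn_leq le lei.
have valE : sval_at (slot_perm H t) (e i) = spoint_int (lift_point e (t (spos i))).
  by rewrite /sval_at -(insert_perm_lift (slot_choice_inj H)).
have fixE p : p \notin codom e -> sval_at (slot_perm H t) p = spoint_int (spos p).
  by rewrite -nf inE /sval_at => /eqP ->.
have jP j := slot_choice_between (excedance t) j H.
have := t0 (spos i); move: valE; rewrite {1}/e {1}/slot_choice.
case: (boolP (excedance t i)) => ex valE ti; rewrite valE fixE.
- move: ex; rewrite /excedance /sval_at !spoint_int_lt /=.
  by case: (t (spos i)) => [[] j] //= /lt; have := jP j; rewrite /e; lia.
- rewrite eE // /e /slot_choice ex; apply/eqP=> hl; by rewrite hl ltnn in lti.
- move: ex ti; rewrite /excedance /sval_at !spoint_int_lt /=.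
  (* Equality would make [i] a fixed point of [t], so a positive value comes from an earlier
     slot. *)
  case: (t (spos i)) => [[] j] //=; rewrite -leqNgt leq_eqVlt.
  case/orP=> [/eqP/val_inj ->|/lt]; first by rewrite eqxx.
  by have := jP j; rewrite /e; lia.
- rewrite eE // /e /slot_choice (negbTE ex); apply/eqP=> hl.
  by rewrite hl ltnn in lti.
Qed.

(** The excedances enter the construction only through the chosen positions, and these can be read
    off from the fixed points of the image; hence injectivity. *)
Lemma slot_perm_choice t i : t \in derangementsB m ->
  slot_choice lo hi (excedance t) i =
  slot_choice lo hi [pred i | lo i \notin fixed_points (slot_perm H t)] i.
Proof.
move=> tD; rewrite {2}/slot_choice /= slot_perm_fixed // negbK.
rewrite (@slot_choice_codom _ _ _ _ _ i) ?leqnn /=; [|by []|by case: H].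
by rewrite /slot_choice; case: (excedance t i); case: eqP.
Qed.

Lemma slot_perm_inj : {in derangementsB m &, injective (slot_perm H)}.
Proof.
move=> t u tD uD tu; apply/permP=> y.
have eE : slot_choice lo hi (excedance t) =1 slot_choice lo hi (excedance u).
  by move=> i; rewrite !slot_perm_choice // tu.
have lE z : lift_point (slot_choice lo hi (excedance t)) z =
            lift_point (slot_choice lo hi (excedance u)) z.
  by rewrite /lift_point eE.
apply: (lift_point_inj (slot_choice_inj (b := excedance u) H)).
have := insert_perm_lift (slot_choice_inj (b := excedance t) H) t y.
by rewrite -/(slot_perm H t) tu !lE => <-; rewrite insert_perm_lift.
Qed.

Lemma slot_perm_onto s :
  s \in slot_perms lo hi -> exists2 t, t \in derangementsB m & s = slot_perm H t.
Proof.
rewrite inE => /and3P[sS /forallP sD /eqP sm]; have [le lt] := H.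
pose b i := lo i \notin fixed_points s.
have bI := slot_choice_inj (b := b) H.
have bM := slot_choice_mono b H.
have nf i : slot_choice lo hi b i \notin fixed_points s.
  rewrite /slot_choice; case: (boolP (b i)) => // /negPn bi.
  have := sD i; rewrite bi; case: ifP => // lti.
  rewrite inE in bi; rewrite /sval_at (eqP bi) => lo_hi.
  rewrite inE; apply/eqP=> hE; move: lo_hi; rewrite hE spoint_int_lt /=; lia.
(* One unfixed position per slot makes [m] of them, which is all there are. *)
have nE : ~: fixed_points s = [set i in codom (slot_choice lo hi b)].
  apply/esym/eqP; rewrite eqEcard sm cardsE card_codom // card_ord leqnn andbT.
  by apply/subsetP=> p; rewrite !inE => /codomP[j ->]; have := nf j; rewrite inE.
have sF i : (i \in fixed_points s) = (i \notin codom (slot_choice lo hi b)).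
  by rewrite -[LHS]negbK -in_setC nE inE.
have [t tD st] := restrict_perm bI sS sF.
have eE i : slot_choice lo hi (excedance t) i = slot_choice lo hi b i.
  have := le i; rewrite leq_eqVlt => /orP[/eqP/val_inj lohi|lti].
    by rewrite /slot_choice lohi !if_same.
  (* The fixed end decides: an unfixed left end has a value above [hi i], an unfixed right end one
     below [lo i]. The increasing relabelling carries this comparison over to [t]. *)
  have := sD i; rewrite lti => lo_hi; congr (if _ then _ else _).
  have := lift_point_lt (spos i) (t (spos i)) bM.
  rewrite /excedance /sval_at -st => <-.
  have -> : lift_point (slot_choice lo hi b) (spos i) = spos (slot_choice lo hi b i).
    by [].
  move: lo_hi (slot_choice_between b i H); rewrite /slot_choice /sval_at.
  have [bi|bi] := boolP (b i).
    have: hi i \in fixed_points s.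
      rewrite sF (@slot_choice_codom _ _ _ _ _ i _ H) ?leqnn ?le //.
      by rewrite /slot_choice bi -val_eqE /= gtn_eqF.
    by rewrite inE => /eqP -> + _; rewrite !spoint_int_lt /=; case: (s _) => [[] j] /=; lia.
  move: bi; rewrite negbK inE => /eqP -> + _; rewrite !spoint_int_lt /=.
  by case: (s _) => [[] j] /=; lia.
have lE y : lift_point (slot_choice lo hi (excedance t)) y =
            lift_point (slot_choice lo hi b) y by rewrite /lift_point eE.
exists t => //; apply/permP=> x.
case: (boolP (x.2 \in codom (slot_choice lo hi b))) => [/lift_pointP[y ->]|xe].
  by rewrite st -!lE insert_perm_lift.
rewrite /slot_perm insert_perm_id ?(eq_codom eE) //.
by apply/eqP; rewrite signed_perm_fixed ?sF.
Qed.

Lemma card_slot_perms (P Q : pred _) :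
  {in derangementsB m, forall t, P (slot_perm H t) = Q t} ->
  #|[set s in slot_perms lo hi | P s]| = #|[set t in derangementsB m | Q t]|.
Proof.
move=> PQ; have -> : [set s in slot_perms lo hi | P s] =
    slot_perm H @: [set t in derangementsB m | Q t].
  apply/setP=> s; apply/setIdP/imsetP => [[/slot_perm_onto[t tD ->]]|[t]].
    by rewrite PQ // => Qt; exists t => //; apply/setIdP.
  by case/setIdP=> tD Qt ->; rewrite PQ // slot_perm_mem.
apply: card_in_imset => t u /setIdP[tD _] /setIdP[uD _]; exact: slot_perm_inj.
Qed.

Lemma slot_perms_fixed_outside s (p : 'I_n) : s \in slot_perms lo hi ->
  (forall i, ~~ (lo i <= p <= hi i)) -> (sval_at s p = p.+1%:Z)%R.
Proof.
case/slot_perm_onto=> t tD -> pout; suff: p \in fixed_points (slot_perm H t).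
  by rewrite inE /sval_at => /eqP ->.
rewrite slot_perm_fixed //; apply/codomP=> -[i pi].
by move: (pout i); rewrite pi slot_choice_between.
Qed.

Lemma slot_perms_bounds s i : s \in slot_perms lo hi -> lo i < hi i ->
  [/\ ((lo i).+1%:Z <= sval_at s (lo i))%R,
      (sval_at s (hi i) < sval_at s (lo i))%R
    & (sval_at s (hi i) <= (hi i).+1%:Z)%R].
Proof.
move=> sS lti; suff: lo i \in fixed_points s \/ hi i \in fixed_points s.
  move: sS; rewrite inE => /and3P[_ /forallP/(_ i)]; rewrite lti => + _.
  by rewrite !inE /sval_at => + [] /eqP hE; rewrite hE /spoint_int /=; split; lia.
have [t tD ->] := slot_perm_onto sS; rewrite !slot_perm_fixed //.
rewrite !(@slot_choice_codom _ _ _ _ _ i) ?leqnn ?(ltnW lti) //.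
rewrite -!val_eqE /= /slot_choice.
by case: (excedance t i); [right|left]; lia.
Qed.

Lemma slot_perm_val t i :
  let e := slot_choice lo hi (excedance t) in
  sval_at (slot_perm H t) (e i) = spoint_int (lift_point e (t (spos i))).
Proof. by move=> e; rewrite /sval_at -(insert_perm_lift (slot_choice_inj H)). Qed.

End SlotPerms.

(** * Slot layouts for alternating permutations *)

(* With 0-based positions: s singleton slots 0, ..., s-1, then positions     *)
(* s, ..., c-1 in no slot, then pairs {c, c+1}, {c+2, c+3}, ...  The types    *)
(* +DU, +UD, -UD, -DU have (s, c) = (0,0), (0,1), (1,1), (2,2).               *)
Definition slot_lo s c m n (i : 'I_m) : 'I_n.+1 :=
  inord (if i < s then i : nat else c + (i - s).*2).

Definition slot_hi s c m n (i : 'I_m) : 'I_n.+1 :=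
  inord (if i < s then i : nat else c + (i - s).*2.+1).

(* The descents are at i = c mod 2: this is altDU for even c, altUD for odd c. *)
Definition alternates c n (s : {perm spoint n}) :=
  forall i j : 'I_n, j = i.+1 :> nat ->
    if odd (i + c) then (sval_at s i < sval_at s j)%R
    else (sval_at s j < sval_at s i)%R.

Lemma altDUP n (s : {perm spoint n}) c :
  ~~ odd c -> reflect (alternates c s) (altDU s).
Proof.
move=> oc; apply: (iffP forallP) => [H i j ij|H i].
  have /forallP/(_ j) := H i; rewrite ij eqxx /= oddD (negbTE oc) addbF.
  by case: odd.
apply/forallP=> j; apply/implyP=> /eqP/H; rewrite oddD (negbTE oc) addbF.
by case: odd.
Qed.

Lemma altUDP n (s : {perm spoint n}) c :
  odd c -> reflect (alternates c s) (altUD s).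
Proof.
move=> oc; apply: (iffP forallP) => [H i j ij|H i].
  have /forallP/(_ j) := H i; rewrite ij eqxx /= oddD oc addbT.
  by case: odd.
apply/forallP=> j; apply/implyP=> /eqP/H; rewrite oddD oc addbT.
by case: odd.
Qed.

Section Blocks.
Context (s c m n : nat) (sc : s <= c <= 2) (sm : s <= m).
Context (mn : c + (m - s).*2 <= n.+1 <= c + (m - s).*2.+1).

Notation lo := (@slot_lo s c m n).
Notation hi := (@slot_hi s c m n).

(** By [mn] the pairs fit into the [n.+1] positions, leaving at most one position after them, so
    [inord] never takes its default value. *)
Lemma slot_loE i : lo i = (if i < s then i : nat else c + (i - s).*2) :> nat.
Proof. by have im := ltn_ord i; rewrite /slot_lo inordK //; case: ifP; lia. Qed.

Lemma slot_hiE i : hi i = (if i < s then i : nat else c + (i - s).*2.+1) :> nat.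
Proof. by have im := ltn_ord i; rewrite /slot_hi inordK //; case: ifP; lia. Qed.

Lemma block_slots : slots lo hi.
Proof.
by split=> [i|i j]; rewrite slot_loE slot_hiE; case: ifP; try case: ifP; lia.
Qed.

Lemma block_slot (p : 'I_n.+1) : c <= p < c + (m - s).*2 ->
  exists i : 'I_m, [/\ s <= i, lo i < hi i & p = if odd (p + c) then hi i else lo i].
Proof.
move=> pb; have im : s + (p - c)./2 < m by lia.
exists (Ordinal im); have [ilo ihi] := (slot_loE (Ordinal im), slot_hiE (Ordinal im)).
move: ilo ihi; rewrite /= ltnNge leq_addr /= => ilo ihi.
split; [by [] | lia |].
by apply/val_inj => /=; case: ifP => op; rewrite ?ilo ?ihi; lia.
Qed.

Lemma slot_perms_lower u (p : 'I_n.+1) : u \in slot_perms lo hi -> c <= p ->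
  ~~ odd (p + c) -> (p.+1%:Z <= sval_at u p)%R.
Proof.
move=> uS cp op; have [pm|mp] := ltnP p (c + (m - s).*2).
  have [|i [_ lti ->]] := block_slot (p := p); first by rewrite cp.
  by rewrite (negbTE op); have [] := slot_perms_bounds block_slots uS lti.
(* A last position without a partner lies in no slot, hence is fixed. *)
rewrite (slot_perms_fixed_outside block_slots uS) // => i.
by have := ltn_ord i; rewrite slot_loE slot_hiE; case: ifP; lia.
Qed.

(** An unpaired last position has the parity of [c], so from [c] on the other parity consists of
    right ends only. *)
Lemma slot_perms_upper u (p : 'I_n.+1) : u \in slot_perms lo hi -> c <= p ->
  odd (p + c) -> (sval_at u p <= p.+1%:Z)%R.
Proof.
move=> uS cp op; have := ltn_ord p; rewrite ltnS => pn.
have [|i [_ lti ->]] := block_slot (p := p); first by lia.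
by rewrite op; have [] := slot_perms_bounds block_slots uS lti.
Qed.

(** At an ascent the value at [p] is at most [p.+1] and the value at [q] at least [q.+1]. The other
    relations are descents inside pairs, except the one between the first two positions when
    [c = 2], which is assumed. *)
Lemma slot_perms_alternate u : u \in slot_perms lo hi ->
  (forall p : 'I_n.+1, p < c -> (sval_at u p <= p.+1%:Z)%R) ->
  (c = 2 -> starts_down u) -> alternates c u.
Proof.
move=> uS up dn p q pq; have [qc|cq] := ltnP q c.
  have c2 : c = 2 by lia.
  have [p0 q1] : p = 0 :> nat /\ q = 1 :> nat by lia.
  have /forallP/(_ p)/forallP/(_ q) := dn c2; rewrite p0 q1 c2 /=; exact.
case: ifP => op.
  have := slot_perms_lower uS cq; rewrite pq addSn /= op => /(_ isT).
  have : (sval_at u p <= p.+1%:Z)%R.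
    by have [/up|cp] := ltnP p c => //; apply: slot_perms_upper.
  lia.
have cp : c <= p by lia.
have [|i [_ lti pi]] := block_slot (p := p); first by have := ltn_ord q; lia.
rewrite op in pi; have -> : q = hi i.
  apply/val_inj; rewrite /= pq slot_hiE; move: lti; rewrite pi slot_hiE slot_loE.
  by case: ifP; lia.
by rewrite pi; have [] := slot_perms_bounds block_slots uS lti.
Qed.

(** Only the descents of [u] are used: they are exactly what the pairs demand. *)
Lemma alternate_slot_perms u : u \in signed_perm n.+1 -> alternates c u ->
  #|fixed_points u| + m = n.+1 ->
  (forall p : 'I_n.+1, p < s -> p \notin fixed_points u) ->
  u \in slot_perms lo hi.
Proof.
move=> uS alt uk neg; rewrite inE uS /=; apply/andP; split; last first.
  by rewrite -(eqn_add2l #|fixed_points u|) cardsC card_ord uk.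
apply/forallP=> i; case: ltnP => [lti|lei].
  have := alt (lo i) (hi i); move: lti; rewrite slot_loE slot_hiE.
  have [si|si _] := ltnP i s; first by lia.
  have -> : odd (c + (i - s).*2 + c) = false by lia.
  by apply; lia.
apply: neg; move: lei; rewrite slot_loE slot_hiE; case: ifP => //; lia.
Qed.

End Blocks.

(** * Conditions on the first values *)

Lemma starts_negE n (u : {perm spoint n}) (i : 'I_n) :
  i = 0 :> nat -> starts_neg u = (sval_at u i < 0)%R.
Proof.
move=> i0; apply/forallP/idP => [/(_ i)|H j]; first by rewrite i0; apply.
by apply/implyP=> /eqP j0; have -> : j = i by apply/val_inj; rewrite /= j0 i0.
Qed.

Lemma starts_posE n (u : {perm spoint n}) (i : 'I_n) :
  i = 0 :> nat -> starts_pos u = (0 < sval_at u i)%R.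
Proof.
move=> i0; apply/forallP/idP => [/(_ i)|H j]; first by rewrite i0; apply.
by apply/implyP=> /eqP j0; have -> : j = i by apply/val_inj; rewrite /= j0 i0.
Qed.

Lemma starts_downE n (u : {perm spoint n}) (i j : 'I_n) :
  i = 0 :> nat -> j = 1 :> nat ->
  starts_down u = (sval_at u j < sval_at u i)%R.
Proof.
move=> i0 j1; apply/forallP/idP => [/(_ i)/forallP/(_ j)|H k].
  by rewrite i0 j1; apply.
apply/forallP=> l; apply/implyP=> /andP[/eqP k0 /eqP l1].
have -> : k = i by apply/val_inj; rewrite /= k0 i0.
by have -> : l = j by apply/val_inj; rewrite /= l1 j1.
Qed.

Lemma sval_at_neg_nonfixed n (u : {perm spoint n}) i :
  (sval_at u i < 0)%R -> i \notin fixed_points u.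
Proof. by rewrite inE /sval_at; apply: contraL => /eqP ->. Qed.

Section Prefix.
Context (c m n : nat) (cc : c <= c <= 2) (c0 : 0 < c) (cm : c <= m).
Context (mn : c + (m - c).*2 <= n.+1 <= c + (m - c).*2.+1).

Notation lo := (@slot_lo c c m n).
Notation hi := (@slot_hi c c m n).
Notation H := (block_slots cc cm mn).

(** With [s = c] the first [c] positions are singleton slots, so insertion leaves the first [c]
    entries in place; relabelling keeps their signs and order. *)
Lemma slot_choice_prefix b (i : 'I_m) : i < c -> slot_choice lo hi b i = i :> nat.
Proof.
move=> ic; have := slot_choice_between b i H.
rewrite slot_loE // slot_hiE // ic; lia.
Qed.

Lemma slot_perm_starts_neg t : starts_neg (slot_perm H t) = starts_neg t.
Proof.
have m0 : 0 < m by lia.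
pose i := Ordinal m0; rewrite (starts_negE t (i := i)) //.
rewrite (starts_negE _ (i := slot_choice lo hi (excedance t) i)); last first.
  by rewrite slot_choice_prefix //=; lia.
by rewrite slot_perm_val /sval_at; case: (t _) => [[] j].
Qed.

Lemma slot_perm_starts_down t : 1 < c ->
  starts_down (slot_perm H t) = starts_down t.
Proof.
move=> c1; have m0 : 0 < m by lia.
have m1 : 1 < m by lia.
have c0' : 0 < c by lia.
pose e := slot_choice lo hi (excedance t).
rewrite (starts_downE t (i := Ordinal m0) (j := Ordinal m1)) //.
rewrite (starts_downE _ (i := e (Ordinal m0)) (j := e (Ordinal m1))).
- by rewrite !slot_perm_val lift_point_lt //; apply: slot_choice_mono H.
- by rewrite /e slot_choice_prefix.
- by rewrite /e slot_choice_prefix.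
Qed.

End Prefix.

(** * The four counts *)

(** Common scheme: [S] and [A] are the sign and alternation conditions of a type, [P] is what
    remains of them on slot permutations, and [Q] is [P] read on derangements. *)
Lemma card_alternating s c m n k (sc : s <= c <= 2) (sm : s <= m)
    (mn : c + (m - s).*2 <= n.+1 <= c + (m - s).*2.+1) (km : k + m = n.+1)
    (S A : pred {perm spoint n.+1}) (P : pred {perm spoint n.+1}) Q :
  (forall u, S u -> A u ->
    [/\ alternates c u, forall p : 'I_n.+1, p < s -> p \notin fixed_points u & P u]) ->
  (forall u, u \in slot_perms (@slot_lo s c m n) (@slot_hi s c m n) ->
    P u -> S u && A u) ->
  (forall t, t \in derangementsB m ->
    P (slot_perm (block_slots sc sm mn) t) = Q t) ->
  #|[set u in signed_perm n.+1 | [&& S u, A u & #|fixed_points u| == k]]| =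
  #|[set t in derangementsB m | Q t]|.
Proof.
move=> fwd bwd PQ; rewrite -(card_slot_perms (H := block_slots sc sm mn) PQ).
congr #|pred_of_set _|; apply/setP=> u; apply/setIdP/setIdP => -[].
  move=> uS /and3P[Su Au /eqP uk]; have [alt neg Pu] := fwd u Su Au.
  by split=> //; apply: alternate_slot_perms; rewrite ?uk.
move=> uS Pu; have /andP[-> ->] := bwd u uS Pu; move: uS; rewrite inE.
case/and3P=> -> _ /eqP um; split=> //=.
by rewrite -(eqn_add2r m) km -{1}um cardsC card_ord.
Qed.

Lemma D_B_predT n : D_B n = #|[set t in derangementsB n | predT t]|.
Proof. by rewrite setIdE setIT. Qed.

Lemma d_pDU_max n : d_pDU (uphalf n.+1) n.+1 = D_B n.+1./2.
Proof.
have sc : 0 <= 0 <= 2 by [].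
have mn : 0 + (n.+1./2 - 0).*2 <= n.+1 <= 0 + (n.+1./2 - 0).*2.+1 by lia.
rewrite D_B_predT.
apply: (card_alternating (sc := sc) (sm := leq0n _) (mn := mn) _ (P := predT)) => //.
- lia.
- by move=> u _ /(altDUP _ (c := 0) isT).
move=> u uS _; apply/andP; split.
  rewrite (starts_posE _ (i := ord0)) //.
  (* The first position is a left end, or unpaired in length 1, so its value is at least 1. *)
  have := slot_perms_lower sc (leq0n _) mn (p := ord0) uS isT isT; lia.
by apply/(altDUP _ (c := 0) isT); apply: slot_perms_alternate uS _ _.
Qed.

Lemma d_pUD_max n : d_pUD (uphalf n.+2) n.+1 = D_B n./2.
Proof.
have sc : 0 <= 1 <= 2 by [].
have mn : 1 + (n./2 - 0).*2 <= n.+1 <= 1 + (n./2 - 0).*2.+1 by lia.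
rewrite D_B_predT.
apply: (card_alternating (sc := sc) (sm := leq0n _) (mn := mn) _ (P := predT)) => //.
- lia.
- by move=> u _ /(altUDP _ (c := 1) isT).
move=> u uS _.
(* The first position precedes all slots, hence is fixed and positive. *)
have first (p : 'I_n.+1) : p < 1 -> (sval_at u p = p.+1%:Z)%R.
  move=> p1; apply: (slot_perms_fixed_outside (block_slots sc (leq0n _) mn) uS) => i.
  by rewrite slot_loE // slot_hiE //=; lia.
apply/andP; split; first by rewrite (starts_posE _ (i := ord0)) // first.
by apply/(altUDP _ (c := 1) isT); apply: slot_perms_alternate uS _ _ => // p /first ->.
Qed.

Lemma starts_neg_nonfixed n (u : {perm spoint n}) (p : 'I_n) :
  starts_neg u -> p < 1 -> p \notin fixed_points u.
Proof.
by move=> un p1; apply: sval_at_neg_nonfixed; rewrite -starts_negE //; lia.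
Qed.

Lemma d_mUD_max n : d_mUD (uphalf n) n.+1 = D_m n.+2./2.
Proof.
have sc : 1 <= 1 <= 2 by [].
have sm : 1 <= n.+2./2 by [].
have mn : 1 + (n.+2./2 - 1).*2 <= n.+1 <= 1 + (n.+2./2 - 1).*2.+1 by lia.
apply: (card_alternating (sc := sc) (sm := sm) (mn := mn) _ (P := @starts_neg n.+1)).
- lia.
- move=> u un /(altUDP _ (c := 1) isT) alt; split=> // p.
  exact: starts_neg_nonfixed.
- move=> u uS un; rewrite un; apply/(altUDP _ (c := 1) isT).
  apply: slot_perms_alternate uS _ _ => // p p1.
  have : (sval_at u p < 0)%R by rewrite -starts_negE //; lia.
  lia.
by move=> t _; apply: slot_perm_starts_neg.
Qed.

Lemma d_mDU_max n : d_mDU (uphalf n) n.+2 = D_mD n.+4./2.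
Proof.
have sc : 2 <= 2 <= 2 by [].
have sm : 2 <= n.+4./2 by [].
have mn : 2 + (n.+4./2 - 2).*2 <= n.+2 <= 2 + (n.+4./2 - 2).*2.+1 by lia.
pose P u := starts_neg u && @starts_down n.+2 u.
(* The first two values are negative, so both positions are unfixed singleton slots. *)
have neg u (p : 'I_n.+2) : P u -> p < 2 -> (sval_at u p < 0)%R.
  case/andP; rewrite (starts_negE _ (i := ord0)) //.
  rewrite (starts_downE _ (i := ord0) (j := inord 1)) ?inordK // => u0 u1 p2.
  have [p0|p1] : p = 0 :> nat \/ p = 1 :> nat by lia.
    by have -> : p = ord0 by apply/val_inj.
  by have -> : p = inord 1; [apply/val_inj; rewrite /= inordK | lia].
apply: (card_alternating (sc := sc) (sm := sm) (mn := mn) _ (P := P)).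
- lia.
- move=> u un /(altDUP _ (c := 2) isT) alt.
  have Pu : P u.
    rewrite /P un (starts_downE _ (i := ord0) (j := inord 1)) ?inordK //.
    by have := alt ord0 (inord 1); rewrite inordK //; apply.
  by split=> // p p2; apply/sval_at_neg_nonfixed/neg.
- move=> u uS Pu; have /andP[-> dn] := Pu; apply/(altDUP _ (c := 2) isT).
  apply: slot_perms_alternate uS _ _ => // p p2.
  by have := neg u p Pu p2; lia.
by move=> t _; rewrite /P slot_perm_starts_neg ?(slot_perm_starts_down sc).
Qed.

(** Length 1 has no room for two singleton slots, but there both order conditions are vacuous. *)
Lemma d_mDU_1 : d_mDU 0 1 = D_mD 1.
Proof.
congr #|pred_of_set _|; apply/setP=> u.
have alt : altDU u.
  by apply/forallP=> i; apply/forallP=> j; rewrite !ord1.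
have dn : starts_down u.
  by apply/forallP=> i; apply/forallP=> j; rewrite !ord1.
apply/setIdP/setIdP=> -[].
  move=> uS /and3P[un _ u0]; rewrite un dn; split=> //.
  by apply/setIdP; rewrite -cards_eq0.
by case/setIdP=> uS u0 /andP[-> _]; rewrite alt cards_eq0.
Qed.

(* [m./2] is the floor and [uphalf m] the ceiling of m/2.  The subtraction    *)
(* n - 2 is truncated only at n = 1, where uphalf 0 = 0 = ceil(-1/2).         *)
Theorem theorem2p5 (n : nat) (hn : 1 <= n) :
  [/\ d_mDU (uphalf (n - 2)) n = D_mD (n + 2)./2,
      d_mUD (uphalf (n - 1)) n = D_m (n + 1)./2,
      d_pDU (uphalf n) n = D_B n./2
    & d_pUD (uphalf (n + 1)) n = D_B (n - 1)./2].
Proof.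
case: n hn => // n _; rewrite subn1 addn1 addn2; split.
- case: n => [|n]; first exact: d_mDU_1.
  by rewrite subn2; apply: d_mDU_max.
- exact: d_mUD_max.
- exact: d_pDU_max.
- exact: d_pUD_max.
Qed.
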